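(* Let $g:[0,1]\to\mathbb{R}$ be the restriction to $[0,1]$ of a real polynomial of degree $2$ such that $g\ge 0$ on $[0,1]$, $\int_0^1 g(x)\,dx=1$ and $g(0)=g(1)\ge 0$. Define $P:[0,1]^2\to\mathbb{R}$ by $P(x,y)=g(x+y)$ if $x+y<1$ and $P(x,y)=g(x+y-1)$ if $x+y\ge 1$, and let $(Lf)(x)=\int_0^1[f(y)-f(x)]P(x,y)\,dy$. Let $b\in\mathbb{R}$ be arbitrary and put $V(x)=b+[1-g(0)]\,x(1-x)$. Then there exist $\lambda\in\mathbb{R}$ and a polynomial $f$ of degree $2$ with $f(0)=f(1)$ such that, for all $x\in[0,1]$, $$(L+V)(f)(x)=\int_0^1 [f(y)-f(x)]P(x,y)\,dy+V(x)f(x)=\lambda f(x).$$ Moreover, there exists such a solution $f$ (for a suitable $\lambda$) which is positive on $[0,1]$.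
   Context: All integrals are with respect to Lebesgue measure on $[0,1]$. *)

(* Defs.v *)
From mathcomp Require Import all_boot all_order all_algebra.
From mathcomp Require Import all_classical all_reals all_analysis.

Set Implicit Arguments.
Unset Strict Implicit.
Unset Printing Implicit Defensive.

Import Order.TTheory GRing.Theory Num.Theory.
Import numFieldNormedType.Exports.

Local Open Scope classical_set_scope.
Local Open Scope ring_scope.

(* Points of [0,1] are elements of R; for x, y in [0,1] only the values of g
   on [0,1] are used. *)
Definition jump_density (R : realType) (g : R -> R) (x y : R) : R :=
  if x + y < 1 then g (x + y) else g (x + y - 1).

(* [Rintegral] is [0] by convention when the integrand is not integrable; for
   polynomial [g] and [f] the integrand below is bounded and measurable. *)
Definition jump_generator (R : realType) (P : R -> R -> R) (f : R -> R)
    (x : R) : R :=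
  \int[@lebesgue_measure R]_(y in `[0, 1]) ((f y - f x) * P x y).

Definition potential (R : realType) (g : R -> R) (b x : R) : R :=
  b + (1 - g 0) * (x * (1 - x)).

Definition schrodinger_op (R : realType) (g : R -> R) (b : R) (f : R -> R)
    (x : R) : R :=
  jump_generator (jump_density g) f x + potential g b x * f x.

(* Main.v *)
(* Write u(x) = x(1-x) and c = g(0), so that g = c + 6(1-c)u.  The convolution
   of u with itself on the circle is 1/30 - u^2/6, hence L u is a combination of
   1, u and u^2 whose u^2 coefficient -(1-c) is cancelled by the potential: L+V
   preserves span(1, u).  On that plane it has the eigenvector
   f = (mu+1) + (1-c)u with eigenvalue b + mu, where
   mu(mu+1) = (1-c)(6-c)/30.  Nonnegativity of g at 1/2 gives c <= 3, which makes
   the larger root mu real and f positive. *)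
Require Import Defs.
From mathcomp Require Import all_boot all_order all_algebra.
From mathcomp Require Import all_classical all_reals all_analysis.
From mathcomp Require Import measurable_realfun ring lra.

Import Order.TTheory GRing.Theory Num.Theory.
Import numFieldNormedType.Exports.

Local Open Scope classical_set_scope.
Local Open Scope ring_scope.

Lemma integrable_horner {R : realType} (p : {poly R}) (s t : R) :
  (@lebesgue_measure R).-integrable `[s, t] (EFin \o horner p).
Proof.
apply: continuous_compact_integrable; first exact: segment_compact.
by apply: continuous_subspaceT => x; exact: continuous_horner.
Qed.

Lemma Rintegral_deriv {R : realType} (p : {poly R}) (s t : R) : s <= t ->
  \int[@lebesgue_measure R]_(x in `[s, t]) (p^`()).[x] = p.[t] - p.[s].
Proof.
rewrite le_eqVlt => /predU1P[->|st].
  by rewrite set_itv1 Rintegral_set1 subrr.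
rewrite /Rintegral (@continuous_FTC2 _ _ (horner p)) //.
- by apply: continuous_subspaceT => x; exact: continuous_horner.
- split=> [x _||]; first exact: derivable_horner.
  + by apply: cvg_at_right_filter; exact: continuous_horner.
  + by apply: cvg_at_left_filter; exact: continuous_horner.
- by move=> x _; rewrite -derive.derivE.
Qed.

(** Splits the integral at [m] and applies the fundamental theorem of calculus on each side. It
    serves integrands in [y] that switch from one polynomial to another at [y = 1 - x]. *)
Lemma Rintegral_piecewise_deriv {R : realType} (h : R -> R) (p r : {poly R})
    (s m t : R) : s <= m -> m <= t ->
  {in `[s, m], h =1 horner p^`()} -> {in `[m, t], h =1 horner r^`()} ->
  \int[@lebesgue_measure R]_(x in `[s, t]) h x =
    (p.[m] - p.[s]) + (r.[t] - r.[m]).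
Proof.
move=> sm mt hp hr.
have mh : measurable_fun `[s, t] h.
  rewrite (@itv_bndbnd_setU _ _ _ (BRight m)) ?bnd_simp//.
  apply/measurable_funU => //; split.
    apply: (eq_measurable_fun (horner p^`())).
      by move=> x; rewrite inE => /hp.
    exact: measurable_poly.
  apply: (eq_measurable_fun (horner r^`())).
    move=> x; rewrite inE /= => xmt; rewrite hr//.
    exact: subset_itv_oc_cc xmt.
  exact: measurable_poly.
have inth : (@lebesgue_measure R).-integrable `[s, t] (EFin \o h).
  have int_norm (q : {poly R}) :
      (@lebesgue_measure R).-integrable `[s, t] (abse \o (EFin \o horner q)).
    by apply: integrable_abse => //; exact: integrable_horner.
  (* The sum of the absolute values of both derivatives dominates [h] on either piece. *)
  apply: (le_integrable _ _ _ (integrableD _ (int_norm p^`()) (int_norm r^`())));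
    rewrite //=; first exact/measurable_EFinP.
  move=> x; rewrite /= in_itv/= => /andP[sx xt].
  rewrite lee_fin [leRHS]ger0_norm ?addr_ge0//.
  have [xm|mx] := leP x m.
    by rewrite hp ?in_itv/= ?sx// lerDl.
  by rewrite hr ?in_itv/= ?xt ?(ltW mx)// lerDr.
have := Rintegral_itvB (x := m) inth; rewrite !bnd_simp => /(_ sm mt).
rewrite Rintegral_itv_obnd_cbnd; last first.
  by apply: integrableS inth => //; exact: subset_itvr.
have -> : \int[@lebesgue_measure R]_(x in `[s, m]) h x = p.[m] - p.[s].
  by rewrite -Rintegral_deriv//; apply: eq_Rintegral => x; rewrite inE => /hp.
have -> : \int[@lebesgue_measure R]_(x in `[m, t]) h x = r.[t] - r.[m].
  by rewrite -Rintegral_deriv//; apply: eq_Rintegral => x; rewrite inE => /hr.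
by move/eqP; rewrite subr_eq addrC => /eqP.
Qed.

(** The antiderivative, zero at 0, of [(u(y) - U) (A + B y + C y^2)]. Here [U] stands for [u(x)],
    and the quadratic for [q] times one branch of the jump density. *)
Definition conv_primitive {R : realType} (U A B C : R) : {poly R} :=
  (- (U * A)) *: 'X + ((A - U * B) / 2) *: 'X^2 +
  ((B - A - U * C) / 3) *: 'X^3 + ((C - B) / 4) *: 'X^4 - (C / 5) *: 'X^5.

Lemma deriv_conv_primitive {R : realType} (U A B C y : R) :
  ((conv_primitive U A B C)^`()).[y] =
    (y * (1 - y) - U) * (A + B * y + C * y ^+ 2).
Proof.
rewrite /conv_primitive !(derivB, derivD, derivZ, derivX, derivXn)/=
  !(hornerD, hornerN, hornerZ, hornerMn, hornerC, hornerXn).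
by field.
Qed.

Lemma horner_conv_primitive {R : realType} (U A B C y : R) :
  (conv_primitive U A B C).[y] =
    - (U * A) * y + (A - U * B) / 2 * y ^+ 2 + (B - A - U * C) / 3 * y ^+ 3
    + (C - B) / 4 * y ^+ 4 - C / 5 * y ^+ 5.
Proof. by rewrite /conv_primitive !hornerE. Qed.

(** Since [f y - f x = q (u(y) - u(x))], the constant [p] drops out. The density has total mass
    [c + a/6], and integrating [u] against it gives [c/6 + a (1/30 - u(x)^2/6)]. *)
Lemma jump_generator_quadratic {R : realType} (c a p q x : R) (g f : R -> R) :
  (forall y, g y = c + a * (y * (1 - y))) ->
  (forall y, f y = p + q * (y * (1 - y))) ->
  x \in `[0, 1]%R ->
  jump_generator (jump_density g) f x =
    q * (c / 6 + a / 30 - (c + a / 6) * (x * (1 - x))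
         - a / 6 * (x * (1 - x)) ^+ 2).
Proof.
move=> gE fE; rewrite in_itv/= => /andP[x0 x1].
(* Both branches come from [u(t + y) = u(t) + (1 - 2t) y - y^2], with [t = x] up to [y = 1 - x] and
   [t = x - 1] beyond. *)
rewrite /jump_generator
  (Rintegral_piecewise_deriv _
    (conv_primitive (x * (1 - x)) (q * (c + a * (x * (1 - x))))
      (q * (a * (1 - 2 * x))) (- (q * a)))
    (conv_primitive (x * (1 - x)) (q * (c + a * ((x - 1) * (2 - x))))
      (q * (a * (3 - 2 * x))) (- (q * a))) 0 (1 - x) 1); first last.
- move=> y; rewrite in_itv/= deriv_conv_primitive /jump_density !gE !fE.
  move=> /andP[xy _]; rewrite ltNge -lerBlDl xy/=; ring.
- move=> y; rewrite in_itv/= deriv_conv_primitive /jump_density !gE !fE.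
  (* At [x + y = 1] the density takes its second branch; the first agrees there because
     [u(0) = u(1)]. *)
  move=> /andP[_]; rewrite lerBrDl le_eqVlt => /predU1P[xy|->]; last by ring.
  by rewrite xy ltxx (_ : y = 1 - x); [ring | lra].
- by rewrite gerBl.
- by rewrite subr_ge0.
by rewrite !horner_conv_primitive; field.
Qed.

(** Equal end values force the coefficients of degree 1 and 2 to be opposite, so together they form
    a multiple of [u]. *)
Lemma horner_quadratic_per {R : comNzRingType} (g : {poly R}) :
  (size g <= 3)%N -> g.[0] = g.[1] ->
  forall x, g.[x] = g.[0] - g`_2 * (x * (1 - x)).
Proof.
move=> sg; have gE x : g.[x] = g`_0 + g`_1 * x + g`_2 * x ^+ 2.
  by rewrite (horner_coef_wide _ sg) !big_ord_recl big_ord0/= /bump/=; ring.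
move=> g01 x; have /eqP : g`_1 + g`_2 = 0.
  by transitivity (g.[1] - g.[0]); [rewrite !gE; ring | rewrite g01 subrr].
by rewrite addr_eq0 !gE => /eqP ->; ring.
Qed.

Lemma Rintegral_quadratic {R : realType} (g : {poly R}) (c a : R) :
  (forall x, g.[x] = c + a * (x * (1 - x))) ->
  \int[@lebesgue_measure R]_(x in `[0, 1]) g.[x] = c + a / 6.
Proof.
move=> gE; pose G := c *: 'X + (a / 2) *: 'X^2 - (a / 3) *: 'X^3.
transitivity (\int[@lebesgue_measure R]_(x in `[0, 1]) (G^`()).[x]).
  by apply: eq_Rintegral => x _; rewrite gE /G
    !(derivB, derivD, derivZ, derivX, derivXn)/=
    !(hornerD, hornerN, hornerZ, hornerMn, hornerC, hornerXn); field.
by rewrite Rintegral_deriv// /G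
  !(hornerD, hornerN, hornerZ, hornerX, hornerXn); field.
Qed.

Theorem theorem1 (R : realType) (g : {poly R})
    (g_deg2 : size g = 3%N)
    (g_ge0 : forall x : R, x \in `[0, 1]%R -> 0 <= g.[x])
    (g_int1 : \int[@lebesgue_measure R]_(x in `[0%R, 1%R]) g.[x] = 1)
    (g_per : g.[0] = g.[1])
    (g0_ge0 : 0 <= g.[0])
    (b : R) :
  (exists (lambda : R) (f : {poly R}),
    [/\ size f = 3%N, f.[0] = f.[1] &
        forall x : R, x \in `[0, 1]%R ->
          schrodinger_op (horner g) b (horner f) x = lambda * f.[x]]) /\
  (exists (lambda : R) (f : {poly R}),
    [/\ size f = 3%N, f.[0] = f.[1],
        forall x : R, x \in `[0, 1]%R ->
          schrodinger_op (horner g) b (horner f) x = lambda * f.[x] &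
        forall x : R, x \in `[0, 1]%R -> 0 < f.[x]]).
Proof.
suff [lambda [f [sf f01 fE fpos]]] : exists (lambda : R) (f : {poly R}),
    [/\ size f = 3%N, f.[0] = f.[1],
        forall x : R, x \in `[0, 1]%R ->
          schrodinger_op (horner g) b (horner f) x = lambda * f.[x] &
        forall x : R, x \in `[0, 1]%R -> 0 < f.[x]].
  by split; exists lambda, f.
have gE := horner_quadratic_per _ (eq_leq g_deg2) g_per.
set c := g.[0] in gE.
(* Unit mass reads [c + a/6 = 1] with [a] the coefficient of [u]. *)
have aE : - g`_2 = 6 * (1 - c).
  move: g_int1; rewrite (Rintegral_quadratic g c (- g`_2)); last first.
    by move=> x; rewrite gE mulNr.
  lra.
have {}gE x : g.[x] = c + 6 * (1 - c) * (x * (1 - x)).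
  by rewrite -aE gE mulNr.
(* Degree exactly 2 for [g] gives this; it in turn gives [f] degree exactly 2. *)
have c1 : 1 - c != 0.
  have : lead_coef g != 0 by rewrite lead_coef_eq0 -size_poly_eq0 g_deg2.
  rewrite lead_coefE g_deg2/= -oppr_eq0 aE; apply: contraNN => /eqP ->.
  by rewrite mulr0.
have c3 : c <= 3.
  have /g_ge0 : (2^-1 : R) \in `[0, 1]%R by rewrite in_itv/=; lra.
  by rewrite gE; lra.
(* The discriminant of the quadratic equation for [mu]; it is at least 1/6, as
   [(1 - c)(6 - c) >= -25/4]. *)
pose D := 1 + 4 * ((1 - c) * (6 - c) / 30).
have D0 : 0 < D by rewrite /D; nra.
have D2 : Num.sqrt D ^+ 2 = D by rewrite sqr_sqrtr// ltW.
have sD : 0 < Num.sqrt D by rewrite sqrtr_gt0.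
pose mu := (Num.sqrt D - 1) / 2.
pose f : {poly R} := Poly [:: mu + 1; 1 - c; - (1 - c)].
have fE x : f.[x] = mu + 1 + (1 - c) * (x * (1 - x)).
  by rewrite /f horner_Poly/=; ring.
have mu2 : mu * (mu + 1) = (1 - c) * (6 - c) / 30.
  have -> : mu * (mu + 1) = (Num.sqrt D ^+ 2 - 1) / 4 by rewrite /mu; field.
  by rewrite D2 /D; field.
exists (b + mu), f; split.
- by rewrite /f (PolyK (c := 0))//= oppr_eq0.
- by rewrite !fE; ring.
- move=> x x01; rewrite /schrodinger_op /potential.
  rewrite (jump_generator_quadratic _ _ _ _ _ _ _ gE fE x01) fE -/c.
  apply/eqP; rewrite -subr_eq0; apply/eqP.
  (* The coefficients of [u] and [u^2] cancel; only the constant term is left. *)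
  transitivity ((1 - c) * (6 - c) / 30 - mu * (mu + 1)); first by field.
  by rewrite mu2 subrr.
- move=> x; rewrite in_itv/= => /andP[x0 x1]; rewrite fE /mu.
  have u0 : 0 <= x * (1 - x) by rewrite mulr_ge0// subr_ge0.
  have u1 : 0 <= 1 / 4 - x * (1 - x).
    by rewrite (_ : _ - _ = (x - 1 / 2) ^+ 2) ?sqr_ge0//; field.
  (* With [mu + 1 = (sqrt D + 1)/2 > 1/2], [1 - c >= -2] and [0 <= u <= 1/4], the value exceeds
     [1/2 - 1/2 = 0]. *)
  nra.
Qed.
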